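(* Let $m,n\ge 2$ and let $\Psi=(\Psi_{i_1\cdots i_m})$ be an $m$-order $n$-dimensional symmetric complex tensor. If a real number $\lambda$ is a Q-eigenvalue of $\Psi$, then $-\lambda$ is also a Q-eigenvalue of $\Psi$.
   Context: An $m$-order $n$-dimensional complex tensor is an array $\Psi=(\Psi_{i_1\cdots i_m})$ with $\Psi_{i_1\cdots i_m}\in\mathbb{C}$ for $i_1,\dots,i_m\in\{1,\dots,n\}$; it is symmetric if its entries are invariant under any permutation of the indices. For $z\in\mathbb{C}^n$, $\Psi z^{m-1}\in\mathbb{C}^n$ is the vector with $i$th component $(\Psi z^{m-1})_i=\sum_{i_2,\dots,i_m=1}^n\Psi_{ii_2\cdots i_m}z_{i_2}\cdots z_{i_m}$. A bar denotes (entrywise) complex conjugation. Q-eigenvalue (quantum eigenvalue): $\lambda$ is a Q-eigenvalue of the symmetric tensor $\Psi$, with Q-eigenvector $z\in\mathbb{C}^n$, if $\Psi z^{m-1}=\lambda\bar z$, $\bar\Psi\bar z^{m-1}=\lambda z$ and $\bar z^\top z=1$. Such $\lambda$ is necessarily real; equivalently, $\lambda\in\mathbb{R}$, $\Psi z^{m-1}=\lambda\bar z$ and $\bar z^\top z=1$. *)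

(* Defs.v *)
From HB Require Import structures.
From mathcomp Require Import all_boot all_order all_algebra all_fingroup.
From mathcomp Require Import reals.
From mathcomp Require Import complex.

Set Implicit Arguments.
Unset Strict Implicit.
Unset Printing Implicit Defensive.

Import Order.TTheory GRing.Theory Num.Theory.
Local Open Scope ring_scope.
Local Open Scope complex_scope.

Section QEigenvalue.
Variables (R : realType) (m n : nat).

Definition tensor := {ffun m.-tuple 'I_n -> R[i]}.

Definition tensor_sym (Psi : tensor) : Prop :=
  forall (s : 'S_m) (t : m.-tuple 'I_n),
    Psi [tuple tnth t (s k) | k < m] = Psi t.

Definition tensor_conj (Psi : tensor) : tensor := [ffun t => (Psi t)^*].

Definition vec_conj (z : 'cV[R[i]]_n) : 'cV[R[i]]_n := map_mx conjc z.

(* The vector Psi z^(m-1).  The tuples t = (i_1, ..., i_m) with i_1 = i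
   enumerate the indices i_2, ..., i_m, which form behead t; this avoids
   casting (m.-1).+1.-tuple to m.-tuple (see tensor_appE).  For m = 0 the sum
   is empty. *)
Definition tensor_app (Psi : tensor) (z : 'cV[R[i]]_n) : 'cV[R[i]]_n :=
  \col_i \sum_(t : m.-tuple 'I_n | ohead t == Some i)
            Psi t * \prod_(j <- behead t) z j 0.

Definition Qeigenpair (Psi : tensor) (lambda : R[i]) (z : 'cV[R[i]]_n) : Prop :=
  [/\ tensor_app Psi z = lambda *: vec_conj z,
      tensor_app (tensor_conj Psi) (vec_conj z) = lambda *: z &
      (vec_conj z)^T *m z = 1%:M].

Definition Qeigenvalue (Psi : tensor) (lambda : R[i]) : Prop :=
  exists z : 'cV[R[i]]_n, Qeigenpair Psi lambda z.

End QEigenvalue.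

Lemma tensor_appE (R : realType) (m n : nat) (Psi : tensor R m.+1 n)
    (z : 'cV[R[i]]_n) (i : 'I_n) :
  tensor_app Psi z i 0 =
    \sum_(t : m.-tuple 'I_n) Psi [tuple of i :: t] * \prod_(j < m) z (tnth t j) 0.
Proof.
rewrite mxE (reindex (fun t : m.-tuple 'I_n => [tuple of i :: t])) /=.
  apply: eq_big => [t|t _]; first by rewrite eqxx.
  by rewrite big_tuple.
exists (fun t : m.+1.-tuple 'I_n => [tuple of behead t]) => [t _|t].
  exact: val_inj.
rewrite inE; case/tupleP: t => j t /= /eqP [->].
exact: val_inj.
Qed.

(* Main.v *)
(* If w ^ m = -1 then w has modulus 1, so w *: z is still a unit vector, and
   w ^ (m-1) = - conj w turns an eigenvector z for lambda into an
   eigenvector w *: z for - lambda. *)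
Require Import Defs.
From HB Require Import structures.
From mathcomp Require Import all_boot all_order all_algebra all_fingroup.
From mathcomp Require Import reals complex.

Set Implicit Arguments.
Unset Strict Implicit.
Unset Printing Implicit Defensive.

Import Order.TTheory GRing.Theory Num.Theory.
Local Open Scope ring_scope.
Local Open Scope complex_scope.

(** [tensor_app Psi] is homogeneous of degree [m.-1], while [vec_conj] is conjugate-linear.
    Rescaling an eigenvector by a unit scalar [w] thus multiplies its eigenvalue by [w ^+ m], and an
    [m]-th root of -1 flips the sign. *)

Lemma tensor_appZ (R : realType) (m n : nat) (Psi : tensor R m n) (a : R[i])
    (z : 'cV[R[i]]_n) :
  tensor_app Psi (a *: z) = a ^+ m.-1 *: tensor_app Psi z.
Proof.
apply/colP => i; rewrite !mxE mulr_sumr; apply: eq_bigr => t _.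
rewrite mulrCA; congr (_ * _).
under eq_bigr do rewrite mxE.
by rewrite big_split /= big_const_seq count_predT iter_mulr_1 size_behead size_tuple.
Qed.

Lemma vec_conjZ (R : realType) (n : nat) (a : R[i]) (z : 'cV[R[i]]_n) :
  vec_conj (a *: z) = a^* *: vec_conj z.
Proof. by apply/colP => i; rewrite !mxE rmorphM. Qed.

Lemma Qeigenpair_opp (R : realType) (m n : nat) (Psi : tensor R m n)
    (lambda w : R[i]) (z : 'cV[R[i]]_n) :
  (0 < m)%N -> w ^+ m = -1 ->
  Qeigenpair Psi lambda z -> Qeigenpair Psi (- lambda) (w *: z).
Proof.
move=> m_gt0 wm [eqz eqzb unitz].
have normw : `|w| = 1.
  by apply/eqP; rewrite -(@pexpr_eq1 _ _ m) // -normrX wm normrN1.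
have wwb : w * w^* = 1 by rewrite -normCK normw expr1n.
(* As [w^*] inverts [w], [w ^+ m.-1] equals [w ^+ m * w^*]. *)
have w_pred : w ^+ m.-1 = - w^*.
  by rewrite -[LHS]mulr1 -wwb mulrA -exprSr prednK // wm mulN1r.
have wb_pred : w^* ^+ m.-1 = - w.
  by rewrite -rmorphXn /= w_pred rmorphN; congr (- _); exact: conjcK.
split; rewrite ?vec_conjZ ?tensor_appZ.
- by rewrite eqz w_pred !scalerA mulNr mulrC -mulNr.
- by rewrite eqzb wb_pred !scalerA mulNr mulrC -mulNr.
- by rewrite -scalemxAr linearZ -scalemxAl scalerA unitz wwb scale1r.
Qed.

Theorem proposition2p1 (R : realType) (m n : nat) (hm : (2 <= m)%N)
  (hn : (2 <= n)%N) (Psi : tensor R m n) (hPsi : tensor_sym Psi) (lambda : R) :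
  Qeigenvalue Psi lambda%:C -> Qeigenvalue Psi (- lambda)%:C.
Proof.
have m_gt0 : (0 < m)%N by exact: ltnW.
(* [R[i]] is algebraically closed, so -1 has an [m]-th root there since [0 < m]. *)
move=> [z eigz]; exists (m.-root (-1) *: z).
by rewrite rmorphN /=; apply: Qeigenpair_opp; rewrite ?rootCK.
Qed.
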